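(* Let $A = (a_{ij})_{i,j=1}^m$ be a bistochastic matrix. Then the following statements hold: (i) The operator $V_A$ on $S^{m-1}$ given by $V_A(x)_k = \Big(\sum_{i=1}^m a_{ki} x_i^2\Big) + x_k(1 - x_k)$, $k = 1, \dots, m$, is a bistochastic operator. (ii) The operator $V$ on $S^{m-1}$ given by $V(x)_k = \frac{1}{m}\Big(\sum_{i=1}^m x_i^2\Big) + x_k(1 - x_k)$, $k = 1, \dots, m$, is a strictly regular quadratic bistochastic operator.
   Context: A bistochastic matrix is a square matrix with nonnegative entries all of whose row sums and column sums equal $1$. $S^{m-1} = \{x = (x_1, \dots, x_m) \in \mathbb{R}^m : \sum_{i=1}^m x_i = 1,\ x_i \ge 0\}$ is the standard simplex. For $x \in S^{m-1}$, let $x_{[1]} \ge \dots \ge x_{[m]}$ be its coordinates in non-increasing order; for $x, y \in S^{m-1}$ write $x \prec y$ if $\sum_{i=1}^k x_{[i]} \le \sum_{i=1}^k y_{[i]}$ for $k = 1, \dots, m-1$. A bistochastic operator is a continuous map $V : S^{m-1} \to S^{m-1}$ with $V(x) \prec x$ for all $x \in S^{m-1}$. A quadratic stochastic operator (QSO) is a map $V : S^{m-1} \to S^{m-1}$ of the form $V(x)_k = \sum_{i,j=1}^m p_{ij,k} x_i x_j$ for $k = 1, \dots, m$, where $p_{ij,k} = p_{ji,k} \ge 0$ and $\sum_{r=1}^m p_{ij,r} = 1$ for all $i, j, k$. A quadratic bistochastic operator (QBO) is a bistochastic QSO. A QSO $V$ is regular if for every $x \in S^{m-1}$ the trajectory $\{V^n(x)\}_{n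 \ge 0}$ converges; a regular QSO is strictly regular if it has a unique fixed point. *)

(* Defs.v *)
From HB Require Import structures.
From mathcomp Require Import all_boot all_order all_algebra.
From mathcomp Require Import all_classical all_reals all_analysis.
Import Order.TTheory GRing.Theory Num.Theory.
Import numFieldNormedType.Exports.

Set Implicit Arguments.
Unset Strict Implicit.
Unset Printing Implicit Defensive.

Local Open Scope classical_set_scope.
Local Open Scope ring_scope.

Definition bistochastic_matrix (R : realType) (m : nat) (A : 'M[R]_m) : Prop :=
  [/\ forall i j, 0 <= A i j,
      forall i, \sum_(j < m) A i j = 1 &
      forall j, \sum_(i < m) A i j = 1].

Definition simplex (R : realType) (m : nat) : set 'rV[R]_m :=
  [set x | \sum_(i < m) x 0 i = 1 /\ forall i, 0 <= x 0 i].

Arguments simplex {R m}.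

(* The coordinates in non-increasing order; since [nth] counts from 0, the
   coordinate x_[k] of the usual notation is [(decreasing x)`_k.-1]. *)
Definition decreasing (R : realType) (m : nat) (x : 'rV[R]_m) : seq R :=
  sort >=%R [seq x 0 i | i <- enum 'I_m].

Definition majorized (R : realType) (m : nat) (x y : 'rV[R]_m) : Prop :=
  forall k : nat, (1 <= k <= m.-1)%N ->
    \sum_(i < k) (decreasing x)`_i <= \sum_(i < k) (decreasing y)`_i.

(* Self-maps of the simplex are represented by total maps of the ambient space
   preserving the simplex; only their values on the simplex matter below. *)
Definition simplex_map (R : realType) (m : nat) (V : 'rV[R]_m -> 'rV[R]_m) : Prop :=
  forall x, simplex x -> simplex (V x).

Definition bistochastic_operator (R : realType) (m : nat)
    (V : 'rV[R]_m -> 'rV[R]_m) : Prop :=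
  [/\ simplex_map V,
      {within simplex, continuous V} &
      forall x, simplex x -> majorized (V x) x].

Definition qso (R : realType) (m : nat) (V : 'rV[R]_m -> 'rV[R]_m) : Prop :=
  simplex_map V /\
  exists p : 'I_m -> 'I_m -> 'I_m -> R,
    [/\ forall i j k, p i j k = p j i k,
        forall i j k, 0 <= p i j k,
        forall i j, \sum_(r < m) p i j r = 1 &
        forall x, simplex x -> forall k,
          V x 0 k = \sum_(i < m) \sum_(j < m) p i j k * x 0 i * x 0 j].

Definition qbo (R : realType) (m : nat) (V : 'rV[R]_m -> 'rV[R]_m) : Prop :=
  bistochastic_operator V /\ qso V.

Definition regular (R : realType) (m : nat) (V : 'rV[R]_m -> 'rV[R]_m) : Prop :=
  qso V /\
  forall x, simplex x ->
    exists2 l, simplex l & (fun n : nat => iter n V x) @ \oo --> l.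

Definition strictly_regular (R : realType) (m : nat)
    (V : 'rV[R]_m -> 'rV[R]_m) : Prop :=
  regular V /\ exists! x, simplex x /\ V x = x.

(* Main.v *)
Require Import Defs.
From mathcomp Require Import all_boot all_order all_algebra.
From mathcomp Require Import all_classical all_reals all_analysis.
From mathcomp Require Import ring lra.
Import Order.TTheory GRing.Theory Num.Theory.
Import numFieldNormedType.Exports.
Local Open Scope classical_set_scope.
Local Open Scope ring_scope.

(** Write [V_A x = A y + z] with [y_i = x_i^2] and [z_i = x_i (1 - x_i)], so that
    [y + z = x]. The idea is that both [y] and [z] are ordered like [x]. For [y]
    this is clear; for [z] it follows from
      [z_i - z_j = (x_i - x_j) (1 - x_i - x_j)]
    because two distinct coordinates of a point of the simplex add up to at most
    1. A set [P] carrying the [k] largest coordinates of [x] therefore also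
    carries the [k] largest coordinates of [y] and of [z]. Summing [V_A x] over
    any [k] indices gives a weighted sum of [y], with weights in [0, 1] of total
    weight [k] since [A] is bistochastic, plus a sum of [k] coordinates of [z].
    By [weighted_sum_le_top] these are at most the sums of [y] and [z] over
    [P], and together at most the sum of [x] over [P]. This is the majorization
    of [V_A x] by [x].

    In (ii) the operator is [V_A] for the matrix with all entries [1/m]. There
    [A y] is constant, so the identity above becomes
      [V(x)_i - V(x)_j = (x_i - x_j) (1 - x_i - x_j)].
    Moreover [V(x)_k >= (1/m) * sum_i x_i^2 >= 1/m^2], so from the first iterate
    on all coordinates are at least [1/m^2] and the differences between
    coordinates shrink geometrically ([uniform_iter_contract]). Every trajectory
    hence converges to the center of the simplex. The center is fixed, and it is
    the only fixed point because the trajectory of a fixed point is constant. *)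

Section QuadraticOperators.
Set Implicit Arguments.
Unset Strict Implicit.
Variables (R : realType) (m : nat).
Implicit Types (A : 'M[R]_m) (x : 'rV[R]_m).

(** * Sums of the largest coordinates *)

Lemma sum_nth_take (s : seq R) k : (k <= size s)%N ->
  \sum_(i < k) s`_i = \sum_(v <- take k s) v.
Proof.
move=> ks; rewrite (big_nth 0) size_takel// big_mkord.
by apply: eq_bigr => i _; rewrite nth_take.
Qed.

(** The partial sums of the sorted coordinates are traded for a set [P] of
    indices, which can be shared by [x] and by any vector ordered like [x]. The
    index [i0] of the smallest coordinate in [P] serves as a threshold: it
    separates [P] from its complement for such vectors too. *)
Lemma top_coordinates x k : (k < m)%N ->
  exists (P : {set 'I_m}) (i0 : 'I_m),
  [/\ #|P| = k.+1,
      \sum_(i < k.+1) (decreasing x)`_i = \sum_(i in P) x 0 i,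
      forall i, i \in P -> x 0 i0 <= x 0 i &
      forall j, j \notin P -> x 0 j <= x 0 i0].
Proof.
move=> km; rewrite /decreasing sort_map.
set r := relpre _ _; set s := sort r _.
have s_size : size s = m by rewrite size_sort size_enum_ord.
have s_uniq : uniq s by rewrite sort_uniq enum_uniq.
have s_mem i : i \in s by rewrite mem_sort mem_enum.
have r_trans : transitive r by move=> i j l /= ij jl; exact: le_trans jl ij.
have s_sorted : pairwise r s.
  by rewrite -sorted_pairwise// sort_sorted// => i j; exact: le_total.
have s1_size : size (take k.+1 s) = k.+1 by rewrite size_takel// s_size.
have s1_uniq : uniq (take k.+1 s) by exact: take_uniq.
rewrite sum_nth_take ?size_map ?s_size// -map_take big_map.
move: s_sorted s_mem; rewrite -{1 2}(cat_take_drop k.+1 s) pairwise_cat.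
case/and3P => /allrelP s12 s1_sorted _ s_mem.
move: s1_size s1_uniq s12 s1_sorted s_mem.
case/lastP: (take k.+1 s) => // s' i0 s1_size s1_uniq s12.
rewrite pairwise_rcons => /andP[/allP s'i0 _] s_mem.
(* The threshold is the last index that makes it into the top [k.+1]. *)
exists [set i in rcons s' i0], i0; split.
- by rewrite cardsE; move/card_uniqP: s1_uniq => ->.
- by rewrite big_uniq//=; apply: eq_bigl => i; rewrite inE.
- by move=> i; rewrite inE mem_rcons inE => /orP[/eqP->|/s'i0].
- move=> j; rewrite inE => js1.
  have := s_mem j; rewrite mem_cat (negbTE js1)/= => js2.
  by apply: (s12 i0 j) => //; rewrite mem_rcons inE eqxx.
Qed.

Lemma sum_mem_mul (I : finType) (P : {set I}) (y : I -> R) :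
  \sum_i (i \in P)%:R * y i = \sum_(i in P) y i.
Proof.
rewrite [RHS]big_mkcond; apply: eq_bigr => i _.
by case: (i \in P); rewrite ?mul1r ?mul0r.
Qed.

Lemma sum_mem (I : finType) (P : {set I}) :
  \sum_i (i \in P)%:R = #|P|%:R :> R.
Proof.
by rewrite -sumr_const -sum_mem_mul; apply: eq_bigr => i _; rewrite mulr1.
Qed.

(** Relative to the indicator of [P], the weights [c] only move mass from
    indices with [y >= t] to indices with [y <= t]. As the total mass is the
    same, subtracting [t] from [y] does not change the difference of the two
    sums, and then every term of that difference is nonnegative. *)
Lemma weighted_sum_le_top (I : finType) (P : {set I}) (c y : I -> R) (t : R) :
  (forall i, 0 <= c i <= 1) -> \sum_i c i = #|P|%:R ->
  (forall i, i \in P -> t <= y i) -> (forall j, j \notin P -> y j <= t) ->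
  \sum_i c i * y i <= \sum_(i in P) y i.
Proof.
move=> c01 c_sum yP yNP.
suff : 0 <= \sum_i ((i \in P)%:R - c i) * (y i - t).
  have -> : \sum_i ((i \in P)%:R - c i) * (y i - t) =
      \sum_i (i \in P)%:R * y i - \sum_i c i * y i
      - t * (\sum_i (i \in P)%:R - \sum_i c i).
    rewrite mulrBr !mulr_sumr -!sumrB; apply: eq_bigr => i _; ring.
  by rewrite sum_mem_mul sum_mem c_sum subrr mulr0 subr0 subr_ge0.
apply: sumr_ge0 => i _; have /andP[c0 c1] := c01 i.
have [iP|iP] := boolP (i \in P).
  by rewrite mulr_ge0// ?subr_ge0// yP.
by rewrite mulr_le0// ?subr_le0// yNP.
Qed.

(** * Majorization *)

Lemma simplex_le1 x i : simplex x -> x 0 i <= 1.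
Proof.
move=> [<- x0]; rewrite (bigD1 i)//= lerDl sumr_ge0// => j _; exact: x0.
Qed.

Lemma simplex_add_le1 x i j : simplex x -> i != j -> x 0 i + x 0 j <= 1.
Proof.
move=> [<- x0] ij; rewrite (bigD1 i)//= (bigD1 j)/= ?(eq_sym j)//.
by rewrite addrA lerDl sumr_ge0// => l _; exact: x0.
Qed.

(** Although [t * (1 - t)] decreases beyond 1/2, at most one coordinate can lie
    there, and the others are then at most its complement to 1. *)
Lemma simplex_logistic_homo x i j : simplex x ->
  x 0 i <= x 0 j -> x 0 i * (1 - x 0 i) <= x 0 j * (1 - x 0 j).
Proof.
move=> xS; have [->//|ij] := eqVneq i j; have := simplex_add_le1 xS ij.
move=> ? ?; nra.
Qed.

Definition quad_op A x : 'rV[R]_m :=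
  \row_(k < m) ((\sum_(i < m) A k i * x 0 i ^+ 2) + x 0 k * (1 - x 0 k)).

Lemma quad_op_simplex A : bistochastic_matrix A -> simplex_map (quad_op A).
Proof.
move=> [A0 _ Acol] x xS; have [x1 x0] := xS; split; last first.
  move=> i; rewrite mxE addr_ge0//.
    by rewrite sumr_ge0// => j _; rewrite mulr_ge0 ?sqr_ge0.
  by rewrite mulr_ge0// subr_ge0 simplex_le1.
under eq_bigr do rewrite mxE.
rewrite big_split/= exchange_big/= -big_split/= -[RHS]x1.
apply: eq_bigr => i _; rewrite -mulr_suml Acol; ring.
Qed.

Lemma quad_op_majorized A x : bistochastic_matrix A -> simplex x ->
  majorized (quad_op A x) x.
Proof.
move=> [A0 Arow Acol] xS [//|k] /andP[_ km]; have [_ x0] := xS.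
have {}km : (k < m)%N by apply: leq_trans km (leq_pred _).
(* [P] holds the top coordinates of [x], and [S] those of [quad_op A x]. *)
have [P [i0 [Pk -> iP iNP]]] := top_coordinates x km.
have [S [_ [Sk -> _ _]]] := top_coordinates (quad_op A x) km.
under eq_bigr do rewrite mxE.
rewrite big_split/= exchange_big/=.
have -> : \sum_(i in P) x 0 i =
    \sum_(i in P) x 0 i ^+ 2 + \sum_(i in P) x 0 i * (1 - x 0 i).
  by rewrite -big_split; apply: eq_bigr => i _ /=; ring.
apply: lerD.
  (* The weight of [x_i^2] is the sum of the entries [A k i] with [k] in [S]. *)
  under eq_bigr do rewrite -mulr_suml.
  apply: (@weighted_sum_le_top _ _ _ _ (x 0 i0 ^+ 2)).
  - move=> i; rewrite sumr_ge0//= -(Acol i).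
    rewrite [leRHS](bigID (mem S))/= lerDl sumr_ge0//.
  - rewrite exchange_big/=; under eq_bigr do rewrite Arow.
    by rewrite sumr_const Sk Pk.
  - by move=> i /iP; rewrite ler_pXn2r// nnegrE.
  - by move=> i /iNP; rewrite ler_pXn2r// nnegrE.
rewrite -[leLHS]sum_mem_mul.
apply: (@weighted_sum_le_top _ _ _ _ (x 0 i0 * (1 - x 0 i0))).
- by move=> i; case: (i \in S); rewrite ?lexx ler01.
- by rewrite sum_mem Sk Pk.
- by move=> i /iP; exact: simplex_logistic_homo.
- by move=> i /iNP; exact: simplex_logistic_homo.
Qed.

(** * Continuity and quadratic form *)

Lemma cvg_row {T : Type} (F : set_system T) {FF : Filter F}
    (f : T -> 'rV[R]_m) (l : 'rV[R]_m) :
  (forall i, f t 0 i @[t --> F] --> l 0 i) -> f @ F --> l.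
Proof.
move=> fl B [P lP PB].
have FP : \forall t \near F, forall i : 'I_m, P 0 i (f t 0 i).
  by apply: filter_forall => i; exact: fl (lP 0 i).
by apply: filterS FP => t Pt; apply: PB => a i; rewrite (ord1 a).
Qed.

Lemma quad_op_continuous A : continuous (quad_op A).
Proof.
move=> x; have xF : Filter (nbhs x) by exact: nbhs_filter.
apply: cvg_row => k.
under eq_fun do rewrite mxE.
rewrite mxE; apply: cvgD.
  apply: cvg_big => [|i _]; first exact: add_continuous.
  apply: cvgM; first exact: cvg_cst.
  by apply: cvgM; exact: coord_continuous.
apply: cvgM; first exact: coord_continuous.
by apply: cvgB; [exact: cvg_cst|exact: coord_continuous].
Qed.

Lemma quad_op_bistochastic A : bistochastic_matrix A ->
  bistochastic_operator (quad_op A).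
Proof.
move=> AB; split; first exact: quad_op_simplex.
  exact/continuous_subspaceT/quad_op_continuous.
by move=> x; exact: quad_op_majorized.
Qed.

Lemma sum_delta (F : 'I_m -> R) k : \sum_i (i == k)%:R * F i = F k.
Proof.
rewrite (bigD1 k)//= eqxx mul1r big1 ?addr0// => i /negbTE ->.
by rewrite mul0r.
Qed.

(** On the simplex [x_k (1 - x_k)] is the sum of [x_k x_j] over [j != k], so an
    offspring of two distinct types is of either parental type with probability
    1/2, while two parents of the same type [i] reproduce according to the
    column [i] of [A]. *)
Lemma quad_op_qso A : bistochastic_matrix A -> qso (quad_op A).
Proof.
move=> AB; split; first exact: quad_op_simplex.
have [A0 Arow Acol] := AB.
exists (fun i j k =>
  if i == j then A k i else 2^-1 * ((k == i)%:R + (k == j)%:R)); split.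
- move=> i j k; rewrite eq_sym; case: eqVneq => [->//|_].
  by rewrite [X in _ * X]addrC.
- move=> i j k /=; case: ifP => [|_]; first by [].
  by rewrite mulr_ge0 ?invr_ge0// addr_ge0.
- move=> i j; case: eqVneq => [_|_]; first exact: Acol.
  rewrite -mulr_sumr big_split/=.
  have d (l : 'I_m) : \sum_r (r == l)%:R = 1 :> R.
    by rewrite -[RHS](sum_delta (fun=> 1) l); under [RHS]eq_bigr do rewrite mulr1.
  by rewrite !d; field.
- move=> x [x1 _] k; rewrite mxE.
  (* The coefficient of [x_i x_j] for distinct parents, extended to [i = j], is
     the indicator of [i = k]; the diagonal therefore needs a correction by
     [A k i - (i == k)]. *)
  have E i j : (if i == j then A k i else 2^-1 * ((k == i)%:R + (k == j)%:R))
      * x 0 i * x 0 j =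
      (j == i)%:R * ((A k i - (i == k)%:R) * x 0 i * x 0 j) +
      2^-1 * ((i == k)%:R * x 0 i * x 0 j + x 0 i * ((j == k)%:R * x 0 j)).
    rewrite !(eq_sym k) (eq_sym j i); case: (eqVneq i j) => [<-|_] /=.
      by field.
    by rewrite mul0r; ring.
  under [RHS]eq_bigr => i _.
    under eq_bigr do rewrite E.
    rewrite big_split/= sum_delta -mulr_sumr big_split/= -!mulr_sumr.
    rewrite sum_delta x1 mulr1.
    over.
  rewrite big_split/= -mulr_sumr big_split/= sum_delta -mulr_suml x1.
  have -> : \sum_i (A k i - (i == k)%:R) * x 0 i * x 0 i =
      \sum_i A k i * x 0 i ^+ 2 - x 0 k ^+ 2.
    rewrite -(sum_delta (fun i => x 0 i ^+ 2)) -sumrB.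
    by apply: eq_bigr => i _; ring.
  by field.
Qed.

(** * Convergence for the uniform matrix *)

Hypothesis m_gt0 : (0 < m)%N.

Let mR_gt0 : 0 < m%:R :> R. Proof. by rewrite ltr0n. Qed.
Let mR_neq0 : m%:R != 0 :> R. Proof. by rewrite gt_eqF. Qed.
Let mR_ge1 : 1 <= m%:R :> R. Proof. by rewrite ler1n. Qed.

Definition uniform_mx : 'M[R]_m := const_mx m%:R^-1.
Definition center : 'rV[R]_m := const_mx m%:R^-1.

Lemma sum_const_inv : \sum_(i < m) m%:R^-1 = 1 :> R.
Proof. by rewrite sumr_const card_ord -[LHS]mulr_natl divff. Qed.

Lemma uniform_mx_bistochastic : bistochastic_matrix uniform_mx.
Proof.
split; first by move=> i j; rewrite mxE invr_ge0.
  by move=> i; rewrite -[RHS]sum_const_inv; apply: eq_bigr => j _; rewrite mxE.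
by move=> j; rewrite -[RHS]sum_const_inv; apply: eq_bigr => i _; rewrite mxE.
Qed.

Lemma center_simplex : simplex center.
Proof.
split; first by rewrite -[RHS]sum_const_inv; apply: eq_bigr => i _; rewrite mxE.
by move=> i; rewrite mxE invr_ge0.
Qed.

Lemma uniform_opE x : quad_op uniform_mx x =
  \row_(k < m) (m%:R^-1 * (\sum_(i < m) x 0 i ^+ 2) + x 0 k * (1 - x 0 k)).
Proof.
apply/rowP => k; rewrite !mxE mulr_sumr; congr (_ + _).
by apply: eq_bigr => i _; rewrite mxE.
Qed.

Lemma center_fixed : quad_op uniform_mx center = center.
Proof.
apply/rowP => k; rewrite uniform_opE !mxE.
under eq_bigr do rewrite mxE expr2.
rewrite -mulr_suml sum_const_inv; ring.
Qed.

Lemma uniform_op_sub x i j :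
  quad_op uniform_mx x 0 i - quad_op uniform_mx x 0 j =
  (1 - x 0 i - x 0 j) * (x 0 i - x 0 j).
Proof. by rewrite uniform_opE !mxE; ring. Qed.

(** The Cauchy-Schwarz bound [sum_i x_i^2 >= 1/m], obtained from the squares
    [(x_i - 1/m)^2]. *)
Lemma uniform_op_ge x k : simplex x -> m%:R^-1 ^+ 2 <= quad_op uniform_mx x 0 k.
Proof.
move=> xS; have [x1 x0] := xS; rewrite uniform_opE mxE.
have sq : m%:R^-1 <= \sum_i x 0 i ^+ 2.
  rewrite -subr_ge0.
  have -> : \sum_i x 0 i ^+ 2 - m%:R^-1 = \sum_i (x 0 i - m%:R^-1) ^+ 2.
    have -> : \sum_i (x 0 i - m%:R^-1) ^+ 2 =
        \sum_i (x 0 i ^+ 2 - 2 * m%:R^-1 * x 0 i + m%:R^-1 * m%:R^-1).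
      by apply: eq_bigr => i _; ring.
    rewrite big_split/= sumrB -mulr_sumr x1 -mulr_suml sum_const_inv; ring.
  by apply: sumr_ge0 => i _; exact: sqr_ge0.
apply: ler_wpDr; first by rewrite mulr_ge0// subr_ge0 simplex_le1.
by rewrite expr2 ler_wpM2l// invr_ge0 ltW.
Qed.

(** Once two coordinates are each at least [1/m^2], the factor [1 - x_i - x_j]
    is at most [1 - 2/m^2]; the weaker [q] is enough. *)
Let q : R := 1 - m%:R^-1 ^+ 2.

Let inv_sq_itv : 0 < (m%:R^-1 ^+ 2 : R) <= 1.
Proof. by rewrite exprn_gt0 ?invr_gt0//= exprn_ile1 ?invf_le1. Qed.

Let q_ge0 : 0 <= q.
Proof. by move: inv_sq_itv; rewrite /q => /andP[? ?]; lra. Qed.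

Lemma uniform_iter_simplex x n : simplex x ->
  simplex (iter n (quad_op uniform_mx) x).
Proof.
move=> xS; elim: n => //= n IH.
by apply: quad_op_simplex => //; exact: uniform_mx_bistochastic.
Qed.

(** The rate is stated for the iterate [n.+1] because the starting point may
    have zero coordinates, so that the first step need not contract. *)
Lemma uniform_iter_contract x n i j : simplex x ->
  `|iter n.+1 (quad_op uniform_mx) x 0 i - iter n.+1 (quad_op uniform_mx) x 0 j|
    <= q ^+ n.
Proof.
move=> xS; have itS n := uniform_iter_simplex n xS.
have [->|ij] := eqVneq i j; first by rewrite subrr normr0 exprn_ge0.
elim: n => [|n IH].
  have [_ y0] := itS 1%N.
  have := simplex_le1 i (itS 1%N); have := simplex_le1 j (itS 1%N).
  have := y0 i; have := y0 j.
  by rewrite expr0 ler_norml => *; apply/andP; split; lra.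
rewrite iterS uniform_op_sub normrM exprS ler_pM//.
have := simplex_add_le1 (itS n.+1) ij.
have := uniform_op_ge i (itS n); have := uniform_op_ge j (itS n).
have /andP[? ?] := inv_sq_itv.
rewrite -iterS /q => *; rewrite ger0_norm; lra.
Qed.

(** The mean of the coordinates is [1/m], so [x_i - 1/m] is the mean over [j] of
    [x_i - x_j]. *)
Lemma dist_center x (e : R) i : simplex x ->
  (forall j, `|x 0 i - x 0 j| <= e) -> `|x 0 i - m%:R^-1| <= e.
Proof.
move=> [x1 _] xe; have -> : x 0 i - m%:R^-1 = m%:R^-1 * \sum_j (x 0 i - x 0 j).
  by rewrite sumrB x1 sumr_const card_ord -[x 0 i *+ m]mulr_natl; field.
rewrite normrM gtr0_norm ?invr_gt0// ler_pdivrMl//.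
apply: le_trans (ler_norm_sum _ _ _) _.
by apply: le_trans (ler_sum _ (fun j _ => xe j)) _; rewrite sumr_const card_ord mulr_natl.
Qed.

Lemma uniform_iter_cvg x : simplex x ->
  (fun n : nat => iter n (quad_op uniform_mx) x) @ \oo --> center.
Proof.
move=> xS; rewrite -cvg_shiftS; apply: cvg_row => i; rewrite mxE.
have q_cvg : q ^+ n @[n --> \oo] --> 0.
  apply: cvg_expr; rewrite ger0_norm//.
  by move: inv_sq_itv => /andP[? ?]; rewrite /q; lra.
apply: (@squeeze_cvgr _ _ _ _ (fun n => m%:R^-1 - q ^+ n)
                              (fun n => m%:R^-1 + q ^+ n)).
- near=> n; rewrite -ler_distl; apply: dist_center.
    exact: uniform_iter_simplex.
  by move=> j; exact: uniform_iter_contract.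
- by rewrite -[X in _ --> X]subr0; apply: cvgB => //; exact: cvg_cst.
- by rewrite -[X in _ --> X]addr0; apply: cvgD => //; exact: cvg_cst.
Unshelve. all: by end_near. Qed.

Lemma uniform_op_strictly_regular : strictly_regular (quad_op uniform_mx).
Proof.
split; first split.
- exact/quad_op_qso/uniform_mx_bistochastic.
- by move=> x xS; exists center; [exact: center_simplex|exact: uniform_iter_cvg].
exists center; split.
  by split; [exact: center_simplex|exact: center_fixed].
move=> x [xS xV]; have := uniform_iter_cvg xS.
under eq_fun do rewrite iter_fix//.
by move=> xc; apply: (cvg_unique (@norm_hausdorff _ _) xc); exact: cvg_cst.
Qed.

End QuadraticOperators.

Theorem theorem4p1 (R : realType) (m : nat) (hm : (1 <= m)%N)
    (A : 'M[R]_m) (hA : bistochastic_matrix A) :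
  bistochastic_operator
    (fun x : 'rV[R]_m =>
       \row_(k < m) ((\sum_(i < m) A k i * x 0 i ^+ 2) + x 0 k * (1 - x 0 k)))
  /\
  (let V := fun x : 'rV[R]_m =>
       \row_(k < m) (m%:R^-1 * (\sum_(i < m) x 0 i ^+ 2)
                     + x 0 k * (1 - x 0 k)) in
   strictly_regular V /\ qbo V).
Proof.
split; first exact: quad_op_bistochastic.
move=> V.
have -> : V = quad_op (uniform_mx R m).
  by apply/funext => x; rewrite uniform_opE.
split; first exact: uniform_op_strictly_regular.
have AB := uniform_mx_bistochastic R hm.
by split; [exact: quad_op_bistochastic|exact: quad_op_qso].
Qed.
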